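(* For positive integers $m$ and $n$, the expression $$(n+1)!\sum_{k=0}^n\frac{1}{k!}\binom{m+k+1}{m}K_{k-m-1}(z)\left(\frac{z}{2}\right)^{k+m}$$ is symmetric with respect to $m$ and $n$; that is, for all positive integers $m,n$ and all $z\in\mathbb{C}\setminus(-\infty,0]$, $$(n+1)!\sum_{k=0}^n\frac{1}{k!}\binom{m+k+1}{m}K_{k-m-1}(z)\left(\frac{z}{2}\right)^{k+m}=(m+1)!\sum_{k=0}^m\frac{1}{k!}\binom{n+k+1}{n}K_{k-n-1}(z)\left(\frac{z}{2}\right)^{k+n}.$$
   Context: $K_\nu$ denotes the modified Bessel function of the second kind (Macdonald function) of order $\nu$, with its principal branch on $\mathbb{C}\setminus(-\infty,0]$; it satisfies $K_{-\nu}=K_\nu$. *)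

(* Defs.v *)
From Stdlib Require Export Reals Factorial.
From Coquelicot Require Export Coquelicot.
Open Scope R_scope.

(* Limits and series of complex values, taken on real and imaginary parts. *)
Definition CLim (f : R -> C) (x : R) : C :=
  (real (Lim (fun t => Re (f t)) x), real (Lim (fun t => Im (f t)) x)).

Definition CSeries (a : nat -> C) : C :=
  (Series (fun k => Re (a k)), Series (fun k => Im (a k))).

Definition Cexp (z : C) : C := (exp (Re z) * cos (Im z), exp (Re z) * sin (Im z)).

(* Principal argument, with values in (-PI, PI] for z <> 0. *)
Definition Carg (z : C) : R :=
  if Rle_dec 0 (Im z) then acos (Re z / Cmod z) else - acos (Re z / Cmod z).

Definition Clog (z : C) : C := (ln (Cmod z), Carg z).

(* Principal branch of z ^ nu for z <> 0. *)
Definition Crpow (z : C) (nu : R) : C := Cexp (RtoC nu * Clog z)%C.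

(* The entire function 1 / Gamma, by Euler's limit
     1 / Gamma(x) = lim_N  x (x + 1) ... (x + N) / (N! N^x);
   it vanishes at 0, -1, -2, ... *)
Definition rGamma (x : R) : R :=
  real (Lim_seq (fun N =>
    prod_f_R0 (fun j => x + INR j) N / (INR (fact N) * Rpower (INR N) x))).

(* Modified Bessel function of the first kind,
     I_nu(z) = sum_k (z/2)^(nu + 2k) / (k! Gamma(nu + k + 1)). *)
Definition besselI (nu : R) (z : C) : C :=
  CSeries (fun k =>
    RtoC (/ INR (fact k) * rGamma (nu + INR k + 1))
    * Crpow (z / 2) (nu + 2 * INR k))%C.

Definition macdonald_quotient (nu : R) (z : C) : C :=
  (RtoC (PI / 2 / sin (nu * PI)) * (besselI (- nu) z - besselI nu z))%C.

(* Macdonald function: the quotient when nu is not an integer, i.e. when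
   sin (nu PI) <> 0, and its limit in the order when nu is an integer.
   Since Lim only looks at points other than nu itself, the value of the
   quotient at the integer is irrelevant. *)
Definition besselK (nu : R) (z : C) : C :=
  if Req_EM_T (sin (nu * PI)) 0
  then CLim (fun mu => macdonald_quotient mu z) nu
  else macdonald_quotient nu z.

Definition slit_plane (z : C) : Prop := ~ (Im z = 0 /\ Re z <= 0).

(* Main.v *)
From Stdlib Require Import ZArith Lra Lia.
Require Import Defs.

(** Put [w = z / 2]. The identity uses only two facts about the sequence
    [K_p], [p] an integer: it is even in [p], and
    [w (K_(p+1) - K_(p-1)) = p K_p].

    Combinatorial part. After division by [(m+1)! (n+1)!] the left side is
    [T m n = sum_(k <= n) a m k], where
    [a m k = (m+k+1)! / (m! (m+1)! k! (k+1)!) w^(m+k) K_(m+1-k)]. The factorial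
    coefficient is symmetric in [m] and [k], and the two facts yield the exchange
    relation [a (n+1) m - a n m = a m (n+1) - a (m-1) (n+1)]
    ([symmetric_term_exchange]; the last term is absent for [m = 0]). Its right side
    telescopes in [m], whence [T (n+1) m - T n m = a m (n+1)], which is also
    [T m (n+1) - T m n] ([symmetric_sum_succ]). So [T m n - T n m] does not depend
    on [n >= m], and it vanishes at [n = m].

    Analytic part. For all real [mu], [besselI] satisfies
    [w (I_(mu-1) - I_(mu+1)) = mu I_mu], a consequence of
    [1 / Gamma x = x / Gamma (x+1)]. The quotient defining [besselK] is visibly even
    in [mu], and it inherits the required recurrence. At an integer order [besselK]
    is a limit of this quotient, and the identities carry over once the limit is
    known to exist ([is_CLim_besselK]). Since [I_(-p) = I_p] for integers [p]
    ([besselI_opp_int]), this reduces to the differentiability of [mu |-> I_mu z].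
    That is obtained from the differentiability of [1 / Gamma] on the positive axis,
    read off Euler's limit in logarithmic form; then from a termwise differentiation
    of the Bessel series for [mu > 0]; then from the recurrence, which reaches all
    lower orders. *)

(** * Term-by-term differentiation *)

(** A term-by-term derivative at one point [x0]. The difference quotients of the
    terms are bounded by a summable [M], uniformly in the increment, so dominated
    convergence lets the limit pass under the sum. Only increments based at [x0]
    are controlled: this is why a pointwise derivative of [rGamma], without any
    bound on its derivative nearby, is enough for the Bessel series. *)
Lemma is_derive_Series (f : nat -> R -> R) (df M : nat -> R) (x0 d : R) :
  0 < d -> ex_series M ->
  (forall k y, Rabs (y - x0) < d -> Rabs (f k y - f k x0) <= M k * Rabs (y - x0)) ->
  (forall k, is_derive (f k) x0 (df k)) ->
  ex_series (fun k => f k x0) ->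
  is_derive (fun y => Series (fun k => f k y)) x0 (Series df).
Proof.
intros Hd HM Hlip Hder Hx0.
assert (Hex : forall y, Rabs (y - x0) < d -> ex_series (fun k => f k y)).
{ intros y Hy.
  apply ex_series_ext with (fun k => plus (f k y - f k x0) (f k x0)).
  - intros k; unfold plus; simpl; ring.
  - apply (ex_series_plus (fun k => f k y - f k x0) (fun k => f k x0)); [|exact Hx0].
    apply (ex_series_le (K := R_AbsRing) (V := R_CompleteNormedModule)
      (fun k => f k y - f k x0) (fun k => M k * Rabs (y - x0))).
    + intros k; apply Hlip, Hy.
    + apply (ex_series_scal_r (Rabs (y - x0)) M HM). }
assert (Hdf : forall k, Rabs (df k) <= M k).
{ intros k.
  destruct (Rle_or_lt (Rabs (df k)) (M k)) as [H|H]; [exact H|exfalso].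
  destruct (proj1 (is_derive_Reals _ _ _) (Hder k) (Rabs (df k) - M k)) as [[e He] Hq];
    [lra|].
  simpl in Hq.
  set (h := Rmin e d / 2).
  assert (0 < Rmin e d) by (apply Rmin_glb_lt; lra).
  assert (Hh : Rabs h = h) by (apply Rabs_pos_eq; unfold h; lra).
  pose proof (Rmin_l e d); pose proof (Rmin_r e d).
  assert (Hh0 : h <> 0) by (unfold h; lra).
  specialize (Hq h Hh0). rewrite Hh in Hq.
  specialize (Hq ltac:(unfold h; lra)).
  assert (Hl := Hlip k (x0 + h)).
  replace (x0 + h - x0) with h in Hl by ring. rewrite Hh in Hl.
  specialize (Hl ltac:(unfold h; lra)).
  assert (Hquot : Rabs ((f k (x0 + h) - f k x0) / h) <= M k).
  { unfold Rdiv. rewrite Rabs_mult, (Rabs_inv h), Hh.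
    assert (0 < h) by (unfold h; lra).
    apply Rmult_le_reg_r with h; [lra|].
    rewrite Rmult_assoc, Rinv_l, Rmult_1_r by lra. exact Hl. }
  pose proof (Rabs_triang_inv (df k) ((f k (x0 + h) - f k x0) / h)).
  rewrite Rabs_minus_sym in Hq. lra. }
assert (Hsdf : ex_series df)
  by (apply (ex_series_le (K := R_AbsRing) (V := R_CompleteNormedModule) df M); [exact Hdf|exact HM]).
apply is_derive_Reals.
intros eps Heps.
(* The k-th quotient differs from its limit by at most [2 * M k]; beyond [N] these
   bounds add up to less than [eps / 2]. *)
assert (Htail : exists N, 2 * Series (fun k => M (S N + k)%nat) < eps / 2).
{ pose proof (Series_correct _ HM) as Hs.
  apply is_lim_seq_Reals in Hs.
  destruct (Hs (eps / 4)) as [N HN]; [lra|].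
  exists N. specialize (HN N (Nat.le_refl _)).
  unfold R_dist in HN.
  rewrite (Series_incr_n M (S N)) in HN by (lia || exact HM).
  rewrite <- sum_n_Reals in HN. simpl pred in HN.
  rewrite sum_n_Reals in HN.
  match type of HN with Rabs (?a - (?a' + ?b)) < _ =>
    replace (a - (a' + b)) with (- b) in HN by (rewrite <- sum_n_Reals; ring) end.
  rewrite Rabs_Ropp in HN. pose proof (Rle_abs (Series (fun k => M (S N + k)%nat))). lra. }
destruct Htail as [N HN].
assert (Hfin : is_derive (fun y => sum_n (fun k => f k y) N) x0 (sum_n df N))
  by (apply (is_derive_sum_n (fun k => f k)); intros; apply Hder).
destruct (proj1 (is_derive_Reals _ _ _) Hfin (eps / 2)) as [[e He] Hq]; [lra|].
assert (Hm : 0 < Rmin e d) by (apply Rmin_glb_lt; lra).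
exists (mkposreal _ Hm). simpl in Hq |- *.
intros h Hh0 Hh.
pose proof (Rmin_l e d); pose proof (Rmin_r e d).
specialize (Hq h Hh0 ltac:(lra)).
assert (Hhd : Rabs (x0 + h - x0) < d) by (replace (x0 + h - x0) with h by ring; lra).
set (g := fun k => (f k (x0 + h) - f k x0) / h - df k).
assert (Hg1 : ex_series (fun k => (f k (x0 + h) - f k x0) / h)).
{ apply (ex_series_scal_r (/ h) (fun k => f k (x0 + h) - f k x0)).
  apply (ex_series_minus (fun k => f k (x0 + h)) (fun k => f k x0)); auto. }
assert (Hg : ex_series g) by (apply (ex_series_minus (fun k => (f k (x0 + h) - f k x0) / h) df); auto).
assert (Hgb : forall k, Rabs (g k) <= 2 * M k).
{ intros k; unfold g.
  eapply Rle_trans; [apply Rabs_triang|]. rewrite Rabs_Ropp.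
  specialize (Hdf k). specialize (Hlip k (x0 + h) Hhd).
  replace (x0 + h - x0) with h in Hlip by ring.
  assert (Rabs ((f k (x0 + h) - f k x0) / h) <= M k); [|lra].
  unfold Rdiv. rewrite Rabs_mult, (Rabs_inv h).
  assert (0 < Rabs h) by (apply Rabs_pos_lt; auto).
  apply Rmult_le_reg_r with (Rabs h); [lra|].
  rewrite Rmult_assoc, Rinv_l, Rmult_1_r by lra. exact Hlip. }
replace ((Series (fun k => f k (x0 + h)) - Series (fun k => f k x0)) / h - Series df)
  with (Series g).
2:{ unfold g. rewrite Series_minus by auto. f_equal.
    unfold Rdiv. rewrite Series_scal_r, Series_minus by auto. reflexivity. }
rewrite (Series_incr_n g (S N)) by (lia || exact Hg).
simpl pred.
eapply Rle_lt_trans; [apply Rabs_triang|].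
replace eps with (eps / 2 + eps / 2) by field.
apply Rplus_lt_compat.
- replace (sum_f_R0 g N) with
    ((sum_n (fun k => f k (x0 + h)) N - sum_n (fun k => f k x0) N) / h - sum_n df N);
    [exact Hq|].
  rewrite !sum_n_Reals. unfold g, Rdiv.
  rewrite minus_sum, <- scal_sum, minus_sum. ring.
- assert (HexM : ex_series (fun k => M (S N + k)%nat)) by (apply (ex_series_incr_n M); exact HM).
  assert (HexM2 : ex_series (fun k => 2 * M (S N + k)%nat)) by (apply (ex_series_scal_l 2 _ HexM)).
  eapply Rle_lt_trans; [|exact HN].
  rewrite <- Series_scal_l.
  assert (Ha : ex_series (fun k => Rabs (g (S N + k)%nat))).
  { apply (ex_series_le (K := R_AbsRing) (V := R_CompleteNormedModule) _ (fun k => 2 * M (S N + k)%nat)); [|exact HexM2].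
    intros k. change (Rabs (Rabs (g (S N + k)%nat)) <= 2 * M (S N + k)%nat). rewrite Rabs_Rabsolu. apply Hgb. }
  eapply Rle_trans; [apply Series_Rabs; exact Ha|].
  apply Series_le; [|exact HexM2].
  intros k; split; [apply Rabs_pos|apply Hgb].
Qed.

(** * The reciprocal Gamma function *)

Lemma exists_nat_shift_pos (x : R) : exists n : nat, 0 < x + INR n.
Proof.
destruct (nfloor_ex (Rabs x)) as [N HN]; [apply Rabs_pos|].
exists (S N). rewrite S_INR. pose proof (Rle_abs (- x)) as H. rewrite Rabs_Ropp in H. lra.
Qed.

Definition euler_quotient (x : R) (N : nat) : R :=
  prod_f_R0 (fun j => x + INR j) N / (INR (fact N) * Rpower (INR N) x).

(** The logarithm of the ratio of the Euler quotients of index [j + 2] and [j + 1];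
    the shift keeps [ln 0], which enters the quotient of index 0, out of it. *)
Definition log_ratio (j : nat) (x : R) : R :=
  ln (1 + x / (INR j + 2)) + x * ln ((INR j + 1) / (INR j + 2)).

Lemma euler_quotient_succ (x : R) (j : nat) : 0 <= x ->
  euler_quotient x (S (S j)) = euler_quotient x (S j) * exp (log_ratio j x).
Proof.
intros Hx. unfold euler_quotient, log_ratio.
pose proof (pos_INR j) as Hj.
assert (Hq : 0 <= x / (INR j + 2)) by (apply Rdiv_le_0_compat; lra).
change (prod_f_R0 (fun j => x + INR j) (S (S j))) with
  (prod_f_R0 (fun j => x + INR j) (S j) * (x + INR (S (S j)))).
rewrite exp_plus, exp_ln by lra.
rewrite ln_div by lra. rewrite Rmult_minus_distr_l.
unfold Rminus. rewrite exp_plus, exp_Ropp.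
rewrite (fact_simpl (S j)), mult_INR. unfold Rpower.
replace (INR (S (S j))) with (INR j + 2) by (rewrite !S_INR; ring).
replace (INR (S j)) with (INR j + 1) by (rewrite !S_INR; ring).
pose proof (exp_pos (x * ln (INR j + 2))). pose proof (exp_pos (x * ln (INR j + 1))).
pose proof (INR_fact_neq_0 (S j)).
field. repeat split; lra.
Qed.

Lemma euler_quotient_exp (x : R) (n : nat) : 0 <= x ->
  euler_quotient x (S (S n)) = x * (x + 1) * exp (sum_n (fun j => log_ratio j x) n).
Proof.
intros Hx.
assert (H1 : euler_quotient x 1 = x * (x + 1)).
{ unfold euler_quotient, Rpower. simpl. rewrite ln_1, Rmult_0_r, exp_0. field. }
induction n as [|n IH]; rewrite euler_quotient_succ by exact Hx.
- rewrite sum_O, H1. reflexivity.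
- rewrite IH, sum_Sn. unfold plus; simpl. rewrite exp_plus. ring.
Qed.

Definition log_ratio' (j : nat) (x : R) : R :=
  / (INR j + 2 + x) + ln ((INR j + 1) / (INR j + 2)).

Lemma is_derive_log_ratio (j : nat) (x : R) : -1 < x ->
  is_derive (log_ratio j) x (log_ratio' j x).
Proof.
intros Hx. pose proof (pos_INR j) as Hj. unfold log_ratio, log_ratio'.
assert (0 < 1 + x / (INR j + 2)).
{ replace (1 + x / (INR j + 2)) with ((INR j + 2 + x) / (INR j + 2)) by (field; lra).
  apply Rdiv_lt_0_compat; lra. }
auto_derive; [lra|]. field. repeat split; lra.
Qed.

(** Both [1 / (j + 2 + x)] and [- ln ((j + 1) / (j + 2))] equal [1 / j] up to
    [O (1 / j ^ 2)], by [ln (1 + u) <= u]. The bound is written as a telescoping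
    difference so that its sum is immediate. *)
Lemma log_ratio'_bound (j : nat) (x : R) : 0 <= x ->
  Rabs (log_ratio' j x) <= (1 + x) * (/ (INR j + 1) - / (INR j + 2)).
Proof.
intros Hx. pose proof (pos_INR j) as Hj. unfold log_ratio'.
assert (Hln : forall u, -1 < u -> ln (1 + u) <= u).
{ intros u Hu. rewrite <- (ln_exp u) at 2. apply ln_le; [lra|apply exp_ineq1_le]. }
assert (Hup : ln ((INR j + 1) / (INR j + 2)) <= - / (INR j + 2)).
{ replace ((INR j + 1) / (INR j + 2)) with (1 + - / (INR j + 2)) by (field; lra).
  apply Hln. assert (/ (INR j + 2) < 1); [|lra].
  rewrite <- Rinv_1. apply Rinv_lt_contravar; lra. }
assert (Hlo : - / (INR j + 1) <= ln ((INR j + 1) / (INR j + 2))).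
{ replace ((INR j + 1) / (INR j + 2)) with (/ (1 + / (INR j + 1))) by (field; lra).
  assert (0 < / (INR j + 1)) by (apply Rinv_0_lt_compat; lra).
  rewrite ln_Rinv by lra. apply Ropp_le_contravar, Hln. lra. }
assert (Hinv : / (INR j + 2 + x) <= / (INR j + 2)) by (apply Rinv_le_contravar; lra).
rewrite Rabs_left1 by lra.
apply Rle_trans with (/ (INR j + 1) - / (INR j + 2 + x)); [lra|].
replace (/ (INR j + 1) - / (INR j + 2 + x)) with ((1 + x) * (/ (INR j + 1) * / (INR j + 2 + x)))
  by (field; split; lra).
replace (/ (INR j + 1) - / (INR j + 2)) with (/ (INR j + 1) * / (INR j + 2))
  by (field; split; lra).
apply Rmult_le_compat_l; [lra|]. apply Rmult_le_compat_l; [|exact Hinv].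
apply Rlt_le, Rinv_0_lt_compat; lra.
Qed.

Lemma log_ratio_lipschitz (j : nat) (b x y : R) : 0 <= x <= b -> 0 <= y <= b ->
  Rabs (log_ratio j y - log_ratio j x)
    <= (1 + b) * (/ (INR j + 1) - / (INR j + 2)) * Rabs (y - x).
Proof.
intros Hx Hy. pose proof (pos_INR j) as Hj.
destruct (MVT_gen (log_ratio j) x y (log_ratio' j)) as [c [Hc E]].
- intros t Ht. apply is_derive_log_ratio.
  pose proof (Rmin_glb x y 0). lra.
- intros t Ht. apply continuity_pt_filterlim.
  apply (ex_derive_continuous (K := R_AbsRing) (V := R_NormedModule) (log_ratio j)).
  exists (log_ratio' j t). apply is_derive_log_ratio.
  pose proof (Rmin_glb x y 0). lra.
- rewrite E, Rabs_mult. apply Rmult_le_compat_r; [apply Rabs_pos|].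
  pose proof (Rmin_glb x y 0). pose proof (Rmax_lub x y b).
  eapply Rle_trans; [apply log_ratio'_bound; lra|].
  apply Rmult_le_compat_r; [|lra].
  assert (/ (INR j + 2) <= / (INR j + 1)) by (apply Rinv_le_contravar; lra). lra.
Qed.

Lemma ex_series_telescope : ex_series (fun j => / (INR j + 1) - / (INR j + 2)).
Proof.
exists 1.
assert (H : is_lim_seq (fun n => 1 - / (INR n + 2)) 1).
{ replace (Finite 1) with (Finite (1 - 0)) by (f_equal; ring).
  apply is_lim_seq_minus'; [apply is_lim_seq_const|].
  apply (is_lim_seq_inv _ p_infty); [|easy].
  apply (is_lim_seq_plus _ _ p_infty 2); [apply is_lim_seq_INR|apply is_lim_seq_const|easy]. }
refine (is_lim_seq_ext _ _ _ _ H).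
intros n. induction n as [|n IH].
- rewrite sum_O. simpl. field.
- rewrite sum_Sn, <- IH. unfold plus; simpl plus. rewrite S_INR.
  pose proof (pos_INR n). change (1 - / (INR n + 1 + 2) = 1 - / (INR n + 2) + (/ (INR n + 1 + 1) - / (INR n + 1 + 2))).
  field; lra.
Qed.

Lemma ex_series_log_ratio (x : R) : 0 <= x -> ex_series (fun j => log_ratio j x).
Proof.
intros Hx.
apply (ex_series_le (K := R_AbsRing) (V := R_CompleteNormedModule) _
  (fun j => (1 + x) * (/ (INR j + 1) - / (INR j + 2)) * x)).
- intros j. change (Rabs (log_ratio j x) <= (1 + x) * (/ (INR j + 1) - / (INR j + 2)) * x).
  assert (H0 : log_ratio j 0 = 0).
  { unfold log_ratio, Rdiv. rewrite !Rmult_0_l, Rplus_0_r, Rplus_0_r. apply ln_1. }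
  pose proof (log_ratio_lipschitz j x 0 x) as H.
  rewrite H0, !Rminus_0_r, (Rabs_pos_eq x) in H by exact Hx.
  apply H; lra.
- apply (ex_series_scal_r x (fun j => (1 + x) * (/ (INR j + 1) - / (INR j + 2)))).
  apply (ex_series_scal_l (1 + x) _ ex_series_telescope).
Qed.

Lemma euler_quotient_lim_pos (x : R) : 0 <= x ->
  is_lim_seq (euler_quotient x) (x * (x + 1) * exp (Series (fun j => log_ratio j x))).
Proof.
intros Hx. apply is_lim_seq_incr_n with 2%nat.
apply is_lim_seq_ext with (fun n => x * (x + 1) * exp (sum_n (fun j => log_ratio j x) n)).
- intros n. rewrite Nat.add_comm. symmetry. apply (euler_quotient_exp x n Hx).
- apply (is_lim_seq_scal_l _ (x * (x + 1)) (exp (Series (fun j => log_ratio j x)))).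
  apply is_lim_seq_continuous.
  + apply derivable_continuous_pt, derivable_pt_exp.
  + apply (Series_correct _ (ex_series_log_ratio x Hx)).
Qed.

Lemma euler_quotient_shift (x : R) (n : nat) : x + INR (S n) + 1 <> 0 ->
  euler_quotient x (S n) =
  x * (INR (S n) / (x + INR (S n) + 1)) * euler_quotient (x + 1) (S n).
Proof.
intros Hx.
assert (P : forall N, prod_f_R0 (fun j => x + INR j) N * (x + INR N + 1) =
                      x * prod_f_R0 (fun j => x + 1 + INR j) N).
{ intros N; induction N as [|N IH]; [simpl; ring|].
  change (prod_f_R0 (fun j => x + INR j) (S N)) with
    (prod_f_R0 (fun j => x + INR j) N * (x + INR (S N))).
  change (prod_f_R0 (fun j => x + 1 + INR j) (S N)) with
    (prod_f_R0 (fun j => x + 1 + INR j) N * (x + 1 + INR (S N))).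
  rewrite <- Rmult_assoc, <- IH, S_INR. ring. }
unfold euler_quotient.
assert (Hn : 0 < INR (S n)) by (apply lt_0_INR; lia).
rewrite Rpower_plus, Rpower_1 by exact Hn.
assert (0 < Rpower (INR (S n)) x) by (unfold Rpower; apply exp_pos).
pose proof (INR_fact_neq_0 (S n)).
replace (prod_f_R0 (fun j => x + INR j) (S n)) with
  (x * prod_f_R0 (fun j => x + 1 + INR j) (S n) / (x + INR (S n) + 1)).
2:{ rewrite <- P. field. exact Hx. }
field. repeat split; try lra; auto.
Qed.

(** Existence of Euler's limit descends from [x + 1] to [x], and the same
    computation gives the functional equation of [1 / Gamma]. *)
Lemma euler_quotient_lim_down (x l : R) :
  is_lim_seq (euler_quotient (x + 1)) l -> is_lim_seq (euler_quotient x) (x * l).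
Proof.
intros H.
assert (Hr : is_lim_seq (fun n => INR n / (x + INR n + 1)) 1).
{ assert (Hinf : is_lim_seq (fun n => x + INR n + 1) p_infty).
  { apply (is_lim_seq_plus _ _ p_infty 1); [|apply is_lim_seq_const|easy].
    apply (is_lim_seq_plus _ _ x p_infty); [apply is_lim_seq_const|apply is_lim_seq_INR|easy]. }
  assert (L : is_lim_seq (fun n => 1 - (x + 1) * / (x + INR n + 1)) 1).
  { replace (Finite 1) with (Finite (1 - (x + 1) * 0)) by (f_equal; ring).
    apply is_lim_seq_minus'; [apply is_lim_seq_const|].
    apply (is_lim_seq_scal_l _ (x + 1) 0).
    apply (is_lim_seq_inv _ p_infty); [exact Hinf|easy]. }
  refine (is_lim_seq_ext_loc _ _ _ _ L).
  assert (Hp : Rbar_locally p_infty (fun y => 0 < y)) by (exists 0; auto).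
  destruct (Hinf _ Hp) as [N HN]. exists N. intros n Hn.
  specialize (HN n Hn). simpl in HN. field. lra. }
assert (Hnz : eventually (fun n => x + INR n + 1 <> 0)).
{ destruct (exists_nat_shift_pos x) as [N HN].
  exists N. intros n Hn. apply le_INR in Hn. lra. }
replace (Finite (x * l)) with (Finite (x * 1 * l)) by (f_equal; ring).
apply is_lim_seq_ext_loc with (fun n => x * (INR n / (x + INR n + 1)) * euler_quotient (x + 1) n).
- destruct Hnz as [N HN]. exists (S N). intros [|n] Hn; [lia|].
  symmetry. apply euler_quotient_shift, HN. lia.
- apply is_lim_seq_mult'; [|exact H].
  apply (is_lim_seq_scal_l _ x 1 Hr).
Qed.

Lemma euler_quotient_cv (x : R) : exists l : R, is_lim_seq (euler_quotient x) l.
Proof.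
assert (H : forall n x, 0 <= x + INR n -> exists l : R, is_lim_seq (euler_quotient x) l).
{ clear x. intros n; induction n as [|n IH]; intros x Hx.
  - simpl in Hx. eexists. apply euler_quotient_lim_pos. lra.
  - destruct (IH (x + 1)) as [l Hl]; [rewrite S_INR in Hx; lra|].
    eexists. apply euler_quotient_lim_down, Hl. }
destruct (exists_nat_shift_pos x) as [N HN]. apply (H N). lra.
Qed.

Lemma rGamma_succ (x : R) : rGamma x = x * rGamma (x + 1).
Proof.
destruct (euler_quotient_cv (x + 1)) as [l Hl].
assert (E1 : rGamma (x + 1) = l)
  by (unfold rGamma; change (real (Lim_seq (euler_quotient (x + 1))) = l);
      rewrite (is_lim_seq_unique _ _ Hl); reflexivity).
rewrite E1. unfold rGamma. change (real (Lim_seq (euler_quotient x)) = x * l).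
rewrite (is_lim_seq_unique _ _ (euler_quotient_lim_down x l Hl)). reflexivity.
Qed.

(** For [x > 0] Euler's limit is [x (x + 1)] times the exponential of a series that
    can be differentiated term by term. *)
Lemma ex_derive_rGamma_pos (x : R) : 0 < x -> ex_derive rGamma x.
Proof.
intros Hx.
apply ex_derive_ext_loc with (fun y => y * (y + 1) * exp (Series (fun j => log_ratio j y))).
- exists (mkposreal x Hx). intros y Hy.
  apply Rabs_def2 in Hy. unfold minus, plus, opp in Hy; simpl in Hy.
  unfold rGamma. change (y * (y + 1) * exp (Series (fun j => log_ratio j y)) =
    real (Lim_seq (euler_quotient y))).
  rewrite (is_lim_seq_unique _ _ (euler_quotient_lim_pos y ltac:(lra))). reflexivity.
- assert (D : ex_derive (fun y => Series (fun j => log_ratio j y)) x).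
  { eexists.
    apply (is_derive_Series log_ratio (fun j => log_ratio' j x)
      (fun j => (1 + 2 * x) * (/ (INR j + 1) - / (INR j + 2))) x x Hx).
    - apply (ex_series_scal_l (1 + 2 * x) _ ex_series_telescope).
    - intros k y Hy. apply Rabs_def2 in Hy. apply log_ratio_lipschitz; lra.
    - intros k. apply is_derive_log_ratio; lra.
    - apply ex_series_log_ratio; lra. }
  apply (ex_derive_mult (fun y => y * (y + 1)) (fun y => exp (Series (fun j => log_ratio j y)))).
  + auto_derive; exact I.
  + apply (ex_derive_comp exp); [|exact D]. auto_derive; exact I.
Qed.

(** * Complex series *)

Definition ex_CSeries (a : nat -> C) : Prop :=
  ex_series (fun k => Re (a k)) /\ ex_series (fun k => Im (a k)).

Lemma CSeries_ext (a b : nat -> C) : (forall k, a k = b k) -> CSeries a = CSeries b.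
Proof.
intros H. unfold CSeries. f_equal; apply Series_ext; intros k; rewrite H; reflexivity.
Qed.

Lemma CSeries_scal (c : C) (a : nat -> C) : ex_CSeries a ->
  CSeries (fun k => (c * a k)%C) = (c * CSeries a)%C.
Proof.
intros [Hr Hi]. unfold CSeries, Cmult. simpl. f_equal.
- rewrite <- (Series_scal_l (fst c)), <- (Series_scal_l (snd c)).
  apply Series_minus; [apply (ex_series_scal_l (fst c) _ Hr)|apply (ex_series_scal_l (snd c) _ Hi)].
- rewrite <- (Series_scal_l (fst c)), <- (Series_scal_l (snd c)).
  apply Series_plus; [apply (ex_series_scal_l (fst c) _ Hi)|apply (ex_series_scal_l (snd c) _ Hr)].
Qed.

Lemma CSeries_plus (a b : nat -> C) : ex_CSeries a -> ex_CSeries b ->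
  CSeries (fun k => (a k + b k)%C) = (CSeries a + CSeries b)%C.
Proof.
intros [Hr Hi] [Hr' Hi']. unfold CSeries, Cplus. simpl.
f_equal; apply Series_plus; assumption.
Qed.

Lemma CSeries_incr_1 (a : nat -> C) : ex_CSeries a ->
  CSeries a = (a 0%nat + CSeries (fun k => a (S k)))%C.
Proof.
intros [Hr Hi]. unfold CSeries, Cplus. simpl.
f_equal; apply (Series_incr_1 (fun k => _ (a k))); assumption.
Qed.

Lemma ex_CSeries_incr_1 (a : nat -> C) : ex_CSeries a -> ex_CSeries (fun k => a (S k)).
Proof.
intros [Hr Hi].
split; [apply (ex_series_incr_1 (fun k => Re (a k))), Hr|apply (ex_series_incr_1 (fun k => Im (a k))), Hi].
Qed.

Lemma ex_CSeries_scal (c : C) (a : nat -> C) : ex_CSeries a ->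
  ex_CSeries (fun k => (c * a k)%C).
Proof.
intros [Hr Hi]. split; simpl.
- apply (ex_series_minus (fun k => fst c * fst (a k)) (fun k => snd c * snd (a k))).
  + apply (ex_series_scal_l (fst c) _ Hr).
  + apply (ex_series_scal_l (snd c) _ Hi).
- apply (ex_series_plus (fun k => fst c * snd (a k)) (fun k => snd c * fst (a k))).
  + apply (ex_series_scal_l (fst c) _ Hi).
  + apply (ex_series_scal_l (snd c) _ Hr).
Qed.

Lemma im_le_Cmod (c : C) : Rabs (Im c) <= Cmod c.
Proof. eapply Rle_trans; [apply Rmax_r|apply Rmax_Cmod]. Qed.

Lemma ex_CSeries_le (a : nat -> C) (b : nat -> R) :
  (forall k, Cmod (a k) <= b k) -> ex_series b -> ex_CSeries a.
Proof.
intros H Hb.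
split; refine (ex_series_le (K := R_AbsRing) (V := R_CompleteNormedModule) _ _ _ Hb);
  intros k; eapply Rle_trans; try apply H; [apply re_le_Cmod|apply im_le_Cmod].
Qed.

(** * The recurrence for the function I *)

Definition besselI_series_term (nu : R) (q : C) (k : nat) : C :=
  (RtoC (/ INR (fact k) * rGamma (nu + INR k + 1)) * q ^ k)%C.

(** The entire factor of [besselI nu z]: the latter is [(z/2) ^ nu] times this
    series at [q = (z/2) ^ 2], so that the branch of the power is confined to one
    factor. *)
Definition besselI_series (nu : R) (q : C) : C := CSeries (besselI_series_term nu q).

(** [rGamma (x + 1) = rGamma x / x], and dividing by [x >= 1] does not increase the
    absolute value; negative orders add only finitely many values. *)
Lemma rGamma_bounded (nu : R) :
  exists B, forall k, Rabs (rGamma (nu + INR k + 1)) <= B.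
Proof.
assert (Hpos : forall nu, 0 <= nu -> exists B, forall k, Rabs (rGamma (nu + INR k + 1)) <= B).
{ clear nu. intros nu Hnu. exists (Rabs (rGamma (nu + 1))). intros k; induction k as [|k IH].
  - simpl. rewrite Rplus_0_r. apply Rle_refl.
  - eapply Rle_trans; [|exact IH].
    pose proof (pos_INR k).
    rewrite (rGamma_succ (nu + INR k + 1)), Rabs_mult, S_INR.
    replace (nu + (INR k + 1) + 1) with (nu + INR k + 1 + 1) by ring.
    rewrite <- (Rmult_1_l (Rabs (rGamma (nu + INR k + 1 + 1)))) at 1.
    apply Rmult_le_compat_r; [apply Rabs_pos|].
    rewrite Rabs_pos_eq; lra. }
assert (H : forall n nu, 0 <= nu + INR n -> exists B, forall k, Rabs (rGamma (nu + INR k + 1)) <= B).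
{ clear nu. intros n; induction n as [|n IH]; intros nu Hnu.
  - apply Hpos. simpl in Hnu. lra.
  - destruct (IH (nu + 1)) as [B HB]; [rewrite S_INR in Hnu; lra|].
    exists (Rmax B (Rabs (rGamma (nu + 1)))). intros [|k].
    + simpl. rewrite Rplus_0_r. apply Rmax_r.
    + eapply Rle_trans; [|apply Rmax_l]. specialize (HB k).
      replace (nu + INR (S k) + 1) with (nu + 1 + INR k + 1) by (rewrite S_INR; ring). exact HB. }
destruct (exists_nat_shift_pos nu) as [N HN]. apply (H N). lra.
Qed.

Lemma ex_series_exp (x : R) : ex_series (fun k => / INR (fact k) * x ^ k).
Proof.
exists (exp x). apply is_pseries_R, is_exp_Reals.
Qed.

Lemma ex_CSeries_besselI_series (nu : R) (q : C) : ex_CSeries (besselI_series_term nu q).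
Proof.
destruct (rGamma_bounded nu) as [B HB].
apply ex_CSeries_le with (fun k => B * (/ INR (fact k) * Cmod q ^ k)).
- intros k. unfold besselI_series_term.
  rewrite Cmod_mult, Cmod_R, Cmod_pow, Rabs_mult.
  assert (0 < / INR (fact k)) by (apply Rinv_0_lt_compat, INR_fact_lt_0).
  rewrite (Rabs_pos_eq (/ _)) by lra.
  replace (B * (/ INR (fact k) * Cmod q ^ k)) with (/ INR (fact k) * B * Cmod q ^ k) by ring.
  apply Rmult_le_compat_r; [apply pow_le, Cmod_ge_0|].
  apply Rmult_le_compat_l; [lra|apply HB].
- apply (ex_series_scal_l B _ (ex_series_exp (Cmod q))).
Qed.

(** Coefficientwise this is [(nu + k) / Gamma (nu + k + 1) = 1 / Gamma (nu + k)],
    the summand [k] cancelling one factor of [k!]. *)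
Lemma besselI_series_recurrence (nu : R) (q : C) :
  besselI_series (nu - 1) q = (RtoC nu * besselI_series nu q + q * besselI_series (nu + 1) q)%C.
Proof.
unfold besselI_series.
rewrite <- (CSeries_scal q) by apply ex_CSeries_besselI_series.
rewrite <- (CSeries_scal (RtoC nu)) by apply ex_CSeries_besselI_series.
rewrite (CSeries_incr_1 (besselI_series_term (nu - 1) q)) by apply ex_CSeries_besselI_series.
rewrite (CSeries_incr_1 (fun k => RtoC nu * besselI_series_term nu q k)%C)
  by apply ex_CSeries_scal, ex_CSeries_besselI_series.
rewrite <- Cplus_assoc, <- CSeries_plus;
  [|apply (ex_CSeries_incr_1 (fun k => RtoC nu * besselI_series_term nu q k)%C), ex_CSeries_scal, ex_CSeries_besselI_series
   |apply ex_CSeries_scal, ex_CSeries_besselI_series].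
f_equal.
- unfold besselI_series_term. rewrite Cmult_assoc, <- RtoC_mult. f_equal. f_equal. simpl INR.
  replace (nu - 1 + 0 + 1) with nu by ring. rewrite (rGamma_succ nu).
  replace (nu + 0 + 1) with (nu + 1) by ring. ring.
- apply CSeries_ext. intros k. unfold besselI_series_term.
  replace (nu - 1 + INR (S k) + 1) with (nu + INR (S k)) by ring.
  rewrite (rGamma_succ (nu + INR (S k))).
  replace (nu + 1 + INR k + 1) with (nu + INR (S k) + 1) by (rewrite S_INR; ring).
  simpl Cpow.
  set (g := rGamma (nu + INR (S k) + 1)).
  replace (/ INR (fact (S k)) * ((nu + INR (S k)) * g)) with
    (nu * (/ INR (fact (S k)) * g) + / INR (fact k) * g).
  + rewrite RtoC_plus, RtoC_mult. ring.
  + rewrite fact_simpl, mult_INR. field. split; [apply INR_fact_neq_0|apply not_0_INR; lia].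
Qed.

Lemma Cexp_plus (a b : C) : Cexp (a + b) = (Cexp a * Cexp b)%C.
Proof.
unfold Cexp, Cmult. simpl. rewrite exp_plus, cos_plus, sin_plus. f_equal; unfold Re, Im; ring.
Qed.

Lemma Crpow_plus (w : C) (a b : R) : Crpow w (a + b) = (Crpow w a * Crpow w b)%C.
Proof.
unfold Crpow. rewrite <- Cexp_plus, RtoC_plus. f_equal. ring.
Qed.

Lemma Crpow_0 (w : C) : Crpow w 0 = RtoC 1.
Proof.
unfold Crpow, Cexp. simpl. rewrite !Rmult_0_l, Rminus_0_r, Rplus_0_r, exp_0, cos_0, sin_0.
unfold RtoC. f_equal; ring.
Qed.

Lemma Crpow_1 (w : C) : w <> RtoC 0 -> Crpow w 1 = w.
Proof.
intros Hw. apply Cmod_gt_0 in Hw.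
unfold Crpow, Cexp, Clog, Carg. simpl.
destruct w as [x y]. set (r := Cmod (x, y)) in *. simpl.
assert (Hr : r * r = x * x + y * y).
{ unfold r, Cmod. simpl. rewrite sqrt_sqrt; [ring|].
  pose proof (Rle_0_sqr x). pose proof (Rle_0_sqr y). unfold Rsqr in *. lra. }
assert (Hb : -1 <= x / r <= 1).
{ apply Rabs_le_between. unfold Rdiv. rewrite Rabs_mult, Rabs_inv, (Rabs_pos_eq r) by lra.
  apply Rmult_le_reg_r with r; [exact Hw|].
  rewrite Rmult_assoc, Rinv_l, Rmult_1_r, Rmult_1_l by lra.
  apply (re_le_Cmod (x, y)). }
assert (Hsq : sqrt (1 - (x / r)²) = Rabs y / r).
{ replace (1 - (x / r)²) with ((Rabs y / r)²).
  - apply sqrt_Rsqr. apply Rdiv_le_0_compat; [apply Rabs_pos|exact Hw].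
  - rewrite !Rsqr_div', <- Rsqr_abs. unfold Rsqr. rewrite Hr.
    field. rewrite <- Hr. apply Rgt_not_eq, Rmult_lt_0_compat; exact Hw. }
destruct (Rle_dec 0 y) as [Hy|Hy].
- replace (1 * ln r - 0 * acos (x / r)) with (ln r) by ring.
  replace (1 * acos (x / r) + 0 * ln r) with (acos (x / r)) by ring.
  rewrite exp_ln, cos_acos, sin_acos, Hsq, Rabs_pos_eq by assumption.
  f_equal; field; lra.
- replace (1 * ln r - 0 * - acos (x / r)) with (ln r) by ring.
  replace (1 * - acos (x / r) + 0 * ln r) with (- acos (x / r)) by ring.
  rewrite cos_neg, sin_neg, exp_ln, cos_acos, sin_acos, Hsq, Rabs_left by (assumption || lra).
  f_equal; field; lra.
Qed.

Lemma Crpow_even (w : C) (k : nat) : w <> RtoC 0 -> Crpow w (2 * INR k) = ((w * w) ^ k)%C.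
Proof.
intros Hw. induction k as [|k IH].
- simpl. rewrite Rmult_0_r. apply Crpow_0.
- rewrite S_INR. replace (2 * (INR k + 1)) with (1 + 1 + 2 * INR k) by ring.
  rewrite !Crpow_plus, IH, Crpow_1 by exact Hw. reflexivity.
Qed.

Lemma half_neq_0 (z : C) : z <> RtoC 0 -> (z / 2)%C <> RtoC 0.
Proof.
intros Hz H. apply Hz. replace z with (2 * (z / 2))%C by (field; apply RtoC_neq; lra).
rewrite H. ring.
Qed.

Lemma besselI_eq_series (nu : R) (z : C) : z <> RtoC 0 ->
  besselI nu z = (Crpow (z / 2) nu * besselI_series nu (z / 2 * (z / 2)))%C.
Proof.
intros Hz. unfold besselI, besselI_series.
rewrite <- CSeries_scal by apply ex_CSeries_besselI_series.
apply CSeries_ext. intros k. unfold besselI_series_term.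
rewrite Crpow_plus, Crpow_even by (apply half_neq_0, Hz). ring.
Qed.

Lemma besselI_recurrence (nu : R) (z : C) : z <> RtoC 0 ->
  (z / 2 * (besselI (nu - 1) z - besselI (nu + 1) z) = RtoC nu * besselI nu z)%C.
Proof.
intros Hz. rewrite !besselI_eq_series by exact Hz. pose proof (half_neq_0 z Hz) as Hw.
set (w := (z / 2)%C) in *.
rewrite (besselI_series_recurrence nu).
replace (Crpow w (nu + 1)) with (w * w * Crpow w (nu - 1))%C.
2:{ replace (nu + 1) with (1 + 1 + (nu - 1)) by ring.
    rewrite !Crpow_plus, Crpow_1 by exact Hw. reflexivity. }
replace (Crpow w nu) with (w * Crpow w (nu - 1))%C.
2:{ replace nu with (1 + (nu - 1)) at 2 by ring.
    rewrite !Crpow_plus, Crpow_1 by exact Hw. reflexivity. }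
ring.
Qed.

(** * Differentiability in the order *)

Definition ex_Cderive (F : R -> C) (x : R) : Prop :=
  ex_derive (fun t => Re (F t)) x /\ ex_derive (fun t => Im (F t)) x.

Lemma ex_Cderive_ext (F G : R -> C) (x : R) : (forall t, F t = G t) ->
  ex_Cderive F x -> ex_Cderive G x.
Proof.
intros H [Hr Hi]. split; [refine (ex_derive_ext _ _ _ _ Hr)|refine (ex_derive_ext _ _ _ _ Hi)];
  intros t; rewrite H; reflexivity.
Qed.

Lemma ex_Cderive_plus (F G : R -> C) (x : R) : ex_Cderive F x -> ex_Cderive G x ->
  ex_Cderive (fun t => (F t + G t)%C) x.
Proof.
intros [Fr Fi] [Gr Gi]. split; simpl.
- apply (ex_derive_plus (fun t => Re (F t)) (fun t => Re (G t))); assumption.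
- apply (ex_derive_plus (fun t => Im (F t)) (fun t => Im (G t))); assumption.
Qed.

Lemma ex_Cderive_mult (F G : R -> C) (x : R) : ex_Cderive F x -> ex_Cderive G x ->
  ex_Cderive (fun t => (F t * G t)%C) x.
Proof.
intros [Fr Fi] [Gr Gi]. split; simpl.
- apply (ex_derive_minus (fun t => Re (F t) * Re (G t)) (fun t => Im (F t) * Im (G t)));
    apply ex_derive_mult; assumption.
- apply (ex_derive_plus (fun t => Re (F t) * Im (G t)) (fun t => Im (F t) * Re (G t)));
    apply ex_derive_mult; assumption.
Qed.

Lemma ex_Cderive_const (c : C) (x : R) : ex_Cderive (fun _ => c) x.
Proof. split; apply ex_derive_const. Qed.

Lemma ex_Cderive_RtoC (x : R) : ex_Cderive (fun t => RtoC t) x.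
Proof. split; simpl; [apply ex_derive_id|apply ex_derive_const]. Qed.

Lemma ex_Cderive_comp (F : R -> C) (g : R -> R) (x : R) :
  ex_Cderive F (g x) -> ex_derive g x -> ex_Cderive (fun t => F (g t)) x.
Proof.
intros [Fr Fi] Hg. split; [apply (ex_derive_comp (fun t => Re (F t)) g)|apply (ex_derive_comp (fun t => Im (F t)) g)]; assumption.
Qed.

Lemma ex_Cderive_Crpow (w : C) (x : R) : ex_Cderive (Crpow w) x.
Proof.
unfold Crpow, Cexp. split; simpl; auto_derive; exact I.
Qed.

Lemma ex_derive_lipschitz (f : R -> R) (x : R) : ex_derive f x ->
  exists d L, 0 < d /\ 0 <= L /\ forall y, Rabs (y - x) < d -> Rabs (f y - f x) <= L * Rabs (y - x).
Proof.
intros [l Hl]. apply is_derive_Reals in Hl.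
destruct (Hl 1) as [[d Hd] H]; [lra|]. simpl in H.
exists d, (Rabs l + 1). split; [exact Hd|]. pose proof (Rabs_pos l). split; [lra|].
intros y Hy. destruct (Req_dec y x) as [->|Hn].
- rewrite !Rminus_diag, Rabs_R0. lra.
- specialize (H (y - x) ltac:(lra) Hy). replace (x + (y - x)) with y in H by ring.
  replace (f y - f x) with ((f y - f x) / (y - x) * (y - x)) by (field; lra).
  rewrite Rabs_mult. apply Rmult_le_compat_r; [apply Rabs_pos|].
  pose proof (Rabs_triang_inv ((f y - f x) / (y - x)) l). lra.
Qed.

(** A Lipschitz estimate for [rGamma] based at [x] is transported to [x + k], with a
    constant that grows only linearly in [k], because each step divides by
    arguments [>= 1]. Against [1 / k!] this growth is harmless. *)
Lemma rGamma_lipschitz_shift (x y L : R) (k : nat) : 1 <= x -> 1 <= y ->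
  Rabs (rGamma y - rGamma x) <= L * Rabs (y - x) ->
  Rabs (rGamma (x + INR k)) <= Rabs (rGamma x) /\
  Rabs (rGamma (y + INR k) - rGamma (x + INR k))
    <= (L + INR k * Rabs (rGamma x)) * Rabs (y - x).
Proof.
intros Hx Hy HL. induction k as [|k [IH1 IH2]].
- simpl. rewrite !Rplus_0_r. split; [apply Rle_refl|]. rewrite Rmult_0_l, Rplus_0_r. exact HL.
- pose proof (pos_INR k). rewrite S_INR, <- !Rplus_assoc.
  assert (E : forall t, 1 <= t -> rGamma (t + INR k + 1) = rGamma (t + INR k) * / (t + INR k)).
  { intros t Ht. rewrite (rGamma_succ (t + INR k)). field. lra. }
  rewrite !E by assumption.
  assert (I : forall t, 1 <= t -> 0 < / (t + INR k) <= 1).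
  { intros t Ht. split; [apply Rinv_0_lt_compat; lra|].
    rewrite <- Rinv_1. apply Rinv_le_contravar; lra. }
  pose proof (I x Hx) as Ix. pose proof (I y Hy) as Iy.
  pose proof (Rabs_pos (rGamma (x + INR k))) as Px.
  pose proof (Rabs_pos (rGamma (y + INR k) - rGamma (x + INR k))) as Pd.
  pose proof (Rabs_pos (y - x)) as Pyx.
  split.
  + rewrite Rabs_mult, (Rabs_pos_eq (/ _)) by lra. nra.
  + replace (rGamma (y + INR k) * / (y + INR k) - rGamma (x + INR k) * / (x + INR k))
      with ((rGamma (y + INR k) - rGamma (x + INR k)) * / (y + INR k)
        - rGamma (x + INR k) * ((y - x) * (/ (x + INR k) * / (y + INR k))))
      by (field; split; lra).
    eapply Rle_trans; [apply Rabs_triang|].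
    rewrite Rabs_Ropp, !Rabs_mult, !(Rabs_pos_eq (/ _)) by lra.
    set (ix := / (x + INR k)) in *. set (iy := / (y + INR k)) in *.
    replace ((L + (INR k + 1) * Rabs (rGamma x)) * Rabs (y - x)) with
      ((L + INR k * Rabs (rGamma x)) * Rabs (y - x) + Rabs (rGamma x) * Rabs (y - x)) by ring.
    apply Rplus_le_compat; [nra|].
    apply Rmult_le_compat; [exact Px| |exact IH1|].
    * apply Rmult_le_pos; [exact Pyx|]. nra.
    * assert (ix * iy <= 1) by nra. nra.
Qed.

Lemma INR_le_pow2 (k : nat) : INR k + 1 <= 2 ^ k.
Proof.
induction k as [|k IH]; [simpl; lra|]. rewrite S_INR. simpl. pose proof (pos_INR k). lra.
Qed.

(** Termwise differentiation, with the majorant [(L + B) (2 |q|) ^ k / k!], where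
    [2 ^ k] absorbs the linear growth of the Lipschitz constants. *)
Lemma ex_Cderive_besselI_series_pos (nu : R) (q : C) : 0 < nu -> ex_Cderive (fun t => besselI_series t q) nu.
Proof.
intros Hnu.
destruct (ex_derive_lipschitz rGamma (nu + 1)) as (d & L & Hd & HL0 & HL).
{ apply ex_derive_rGamma_pos. lra. }
set (B := Rabs (rGamma (nu + 1))). assert (0 <= B) by apply Rabs_pos.
assert (Main : forall r : nat -> R, (forall k, Rabs (r k) <= Cmod q ^ k) ->
  ex_derive (fun t => Series (fun k => / INR (fact k) * rGamma (t + INR k + 1) * r k)) nu).
{ intros r Hr. eexists.
  apply (is_derive_Series (fun k t => / INR (fact k) * rGamma (t + INR k + 1) * r k)
    (fun k => Derive (fun t => / INR (fact k) * rGamma (t + INR k + 1) * r k) nu)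
    (fun k => (L + B) * (/ INR (fact k) * (2 * Cmod q) ^ k)) nu (Rmin d nu)).
  - apply Rmin_glb_lt; assumption.
  - apply (ex_series_scal_l (L + B) _ (ex_series_exp (2 * Cmod q))).
  - intros k y Hy. pose proof (Rmin_l d nu). pose proof (Rmin_r d nu).
    assert (Hy1 : 0 < y) by (apply Rabs_def2 in Hy; lra).
    assert (HLy : Rabs (rGamma (y + 1) - rGamma (nu + 1)) <= L * Rabs (y + 1 - (nu + 1))).
    { apply HL. replace (y + 1 - (nu + 1)) with (y - nu) by ring. lra. }
    destruct (rGamma_lipschitz_shift (nu + 1) (y + 1) L k ltac:(lra) ltac:(lra) HLy) as [_ Hk].
    replace (y + 1 - (nu + 1)) with (y - nu) in Hk by ring. fold B in Hk.
    replace (y + INR k + 1) with (y + 1 + INR k) by ring.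
    replace (nu + INR k + 1) with (nu + 1 + INR k) by ring.
    rewrite <- Rmult_minus_distr_r, <- Rmult_minus_distr_l, !Rabs_mult.
    assert (0 < / INR (fact k)) by (apply Rinv_0_lt_compat, INR_fact_lt_0).
    rewrite (Rabs_pos_eq (/ _)) by lra.
    rewrite Rpow_mult_distr.
    replace ((L + B) * (/ INR (fact k) * (2 ^ k * Cmod q ^ k)) * Rabs (y - nu)) with
      (/ INR (fact k) * ((L + B) * 2 ^ k * Rabs (y - nu)) * Cmod q ^ k) by ring.
    apply Rmult_le_compat; [|apply Rabs_pos| |apply Hr].
    + apply Rmult_le_pos; [lra|apply Rabs_pos].
    + apply Rmult_le_compat_l; [lra|]. eapply Rle_trans; [exact Hk|].
      apply Rmult_le_compat_r; [apply Rabs_pos|].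
      pose proof (INR_le_pow2 k). pose proof (pos_INR k). nra.
  - intros k. apply Derive_correct.
    apply (ex_derive_mult (fun t => / INR (fact k) * rGamma (t + INR k + 1)) (fun _ => r k));
      [|apply ex_derive_const].
    apply (ex_derive_mult (fun _ => / INR (fact k)) (fun t => rGamma (t + INR k + 1)));
      [apply ex_derive_const|].
    apply (ex_derive_comp rGamma (fun t => t + INR k + 1)).
    + apply ex_derive_rGamma_pos. pose proof (pos_INR k). lra.
    + auto_derive; exact I.
  - destruct (rGamma_bounded nu) as [b Hb].
    apply (ex_series_le (K := R_AbsRing) (V := R_CompleteNormedModule) _
      (fun k => b * (/ INR (fact k) * Cmod q ^ k))).
    + intros k. change (Rabs (/ INR (fact k) * rGamma (nu + INR k + 1) * r k)
         <= b * (/ INR (fact k) * Cmod q ^ k)).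
      assert (0 < / INR (fact k)) by (apply Rinv_0_lt_compat, INR_fact_lt_0).
      rewrite !Rabs_mult, (Rabs_pos_eq (/ _)) by lra.
      replace (b * (/ INR (fact k) * Cmod q ^ k)) with (/ INR (fact k) * b * Cmod q ^ k) by ring.
      apply Rmult_le_compat; [apply Rmult_le_pos; [lra|apply Rabs_pos]|apply Rabs_pos| |apply Hr].
      apply Rmult_le_compat_l; [lra|apply Hb].
    + apply (ex_series_scal_l b _ (ex_series_exp (Cmod q))). }
split; unfold besselI_series, CSeries; simpl.
- refine (ex_derive_ext _ _ _ _ (Main (fun k => Re (q ^ k)%C) _)).
  + intros t. apply Series_ext. intros k. simpl. unfold Re. ring.
  + intros k. rewrite <- Cmod_pow. apply re_le_Cmod.
- refine (ex_derive_ext _ _ _ _ (Main (fun k => Im (q ^ k)%C) _)).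
  + intros t. apply Series_ext. intros k. simpl. unfold Im. ring.
  + intros k. rewrite <- Cmod_pow. apply im_le_Cmod.
Qed.

(** The three-term recurrence expresses order [nu] through orders [nu + 1] and
    [nu + 2], so differentiability descends from positive orders to all orders. *)
Lemma ex_Cderive_besselI_series (nu : R) (q : C) : ex_Cderive (fun t => besselI_series t q) nu.
Proof.
assert (H : forall n nu, 0 < nu + INR n ->
  ex_Cderive (fun t => besselI_series t q) nu /\ ex_Cderive (fun t => besselI_series t q) (nu + 1)).
{ clear nu. intros n; induction n as [|n IH]; intros nu Hnu.
  - simpl in Hnu. split; apply ex_Cderive_besselI_series_pos; lra.
  - destruct (IH (nu + 1)) as [H1 H2]; [rewrite S_INR in Hnu; lra|]. split; [|exact H1].
    apply ex_Cderive_ext with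
      (fun t => (RtoC (t + 1) * besselI_series (t + 1) q + q * besselI_series (t + 1 + 1) q)%C).
    { intros t. rewrite <- besselI_series_recurrence. f_equal. ring. }
    apply ex_Cderive_plus; apply ex_Cderive_mult.
    + apply (ex_Cderive_comp RtoC (fun t => t + 1)); [apply ex_Cderive_RtoC|auto_derive; exact I].
    + apply (ex_Cderive_comp (fun t => besselI_series t q) (fun t => t + 1)); [exact H1|auto_derive; exact I].
    + apply ex_Cderive_const.
    + apply (ex_Cderive_comp (fun t => besselI_series t q) (fun t => t + 1 + 1)); [exact H2|auto_derive; exact I]. }
destruct (exists_nat_shift_pos nu) as [N HN]. apply (H N). lra.
Qed.

Lemma ex_Cderive_besselI (nu : R) (z : C) : z <> RtoC 0 ->
  ex_Cderive (fun t => besselI t z) nu.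
Proof.
intros Hz.
apply ex_Cderive_ext with (fun t => Crpow (z / 2) t * besselI_series t (z / 2 * (z / 2)))%C.
- intros t. symmetry. apply besselI_eq_series, Hz.
- apply ex_Cderive_mult; [apply ex_Cderive_Crpow|apply ex_Cderive_besselI_series].
Qed.

(** * The Macdonald function at integer orders *)

(** The differences [D n = besselI (- n) z - besselI n z] satisfy a three-term
    recurrence in [n]; [D 0 = 0] trivially, and the recurrence for [besselI] at
    order 0 says [D 1 = 0]. *)
Lemma besselI_opp_int (p : Z) (z : C) : z <> RtoC 0 ->
  besselI (- IZR p) z = besselI (IZR p) z.
Proof.
intros Hz.
assert (H : forall n : nat, besselI (- INR n) z = besselI (INR n) z /\
                            besselI (- INR (S n)) z = besselI (INR (S n)) z).
{ assert (Cancel : forall a b : C, (z / 2 * a = z / 2 * b)%C -> a = b).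
  { intros a b E. replace a with ((z / 2 * a) / (z / 2))%C by (field; exact Hz).
    rewrite E. field. exact Hz. }
  intros n; induction n as [|n [IH0 IH1]].
  - simpl. split; [rewrite Ropp_0; reflexivity|].
    apply Cancel. pose proof (besselI_recurrence 0 z Hz) as E.
    rewrite Rplus_0_l, Rminus_0_l in E.
    replace (z / 2 * besselI (- (1)) z)%C with
      (z / 2 * (besselI (- (1)) z - besselI 1 z) + z / 2 * besselI 1 z)%C by ring.
    rewrite E. ring.
  - split; [exact IH1|]. apply Cancel.
    pose proof (besselI_recurrence (INR (S n)) z Hz) as E1.
    pose proof (besselI_recurrence (- INR (S n)) z Hz) as E2.
    replace (INR (S n) - 1) with (INR n) in E1 by (rewrite S_INR; ring).
    replace (- INR (S n) + 1) with (- INR n) in E2 by (rewrite S_INR; ring).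
    replace (- INR (S n) - 1) with (- INR (S (S n))) in E2 by (rewrite (S_INR (S n)); ring).
    rewrite <- (S_INR (S n)) in E1.
    rewrite IH0, IH1, RtoC_opp in E2.
    set (s := INR (S (S n))) in *.
    replace (z / 2 * besselI (- s) z)%C with
      (z / 2 * (besselI (- s) z - besselI (INR n) z) + z / 2 * besselI (INR n) z)%C by ring.
    rewrite E2.
    replace (- RtoC (INR (S n)) * besselI (INR (S n)) z)%C with
      (- (RtoC (INR (S n)) * besselI (INR (S n)) z))%C by ring.
    rewrite <- E1. ring. }
destruct (Z.le_gt_cases 0 p) as [Hp|Hp].
- rewrite <- (Z2Nat.id p Hp), <- INR_IZR_INZ. exact (proj1 (H (Z.to_nat p))).
- replace p with (- Z.of_nat (Z.to_nat (- p)))%Z by lia.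
  rewrite opp_IZR, Ropp_involutive, <- INR_IZR_INZ. symmetry.
  exact (proj1 (H (Z.to_nat (- p)))).
Qed.

Definition is_CLim (F : R -> C) (x : R) (l : C) : Prop :=
  is_lim (fun t => Re (F t)) x (Re l) /\ is_lim (fun t => Im (F t)) x (Im l).

Lemma is_CLim_unique (F : R -> C) (x : R) (l : C) : is_CLim F x l -> CLim F x = l.
Proof.
intros [Hr Hi]. unfold CLim. rewrite (is_lim_unique _ _ _ Hr), (is_lim_unique _ _ _ Hi).
destruct l; reflexivity.
Qed.

Lemma is_CLim_ext (F G : R -> C) (x : R) (l : C) : (forall t, F t = G t) ->
  is_CLim F x l -> is_CLim G x l.
Proof.
intros H [Hr Hi]. split; [refine (is_lim_ext _ _ _ _ _ Hr)|refine (is_lim_ext _ _ _ _ _ Hi)];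
  intros t; rewrite H; reflexivity.
Qed.

Lemma is_CLim_mult (F G : R -> C) (x : R) (l l' : C) : is_CLim F x l -> is_CLim G x l' ->
  is_CLim (fun t => (F t * G t)%C) x (l * l')%C.
Proof.
intros [Fr Fi] [Gr Gi].
assert (P : forall (f g : R -> R) (a b : R), is_lim f x a -> is_lim g x b ->
  is_lim (fun t => f t * g t) x (a * b)).
{ intros f g a b Hf Hg. exact (is_lim_mult f g x a b Hf Hg I). }
split; simpl.
- apply (is_lim_minus' (fun t => Re (F t) * Re (G t)) (fun t => Im (F t) * Im (G t)));
    apply P; assumption.
- apply (is_lim_plus' (fun t => Re (F t) * Im (G t)) (fun t => Im (F t) * Re (G t)));
    apply P; assumption.
Qed.

Lemma is_CLim_minus (F G : R -> C) (x : R) (l l' : C) : is_CLim F x l -> is_CLim G x l' ->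
  is_CLim (fun t => (F t - G t)%C) x (l - l')%C.
Proof.
intros [Fr Fi] [Gr Gi].
split; simpl; [apply (is_lim_minus' (fun t => Re (F t)) (fun t => Re (G t)))
  |apply (is_lim_minus' (fun t => Im (F t)) (fun t => Im (G t)))]; assumption.
Qed.

Lemma is_CLim_const (c : C) (x : R) : is_CLim (fun _ => c) x c.
Proof. split; apply is_lim_const. Qed.

Lemma is_CLim_RtoC (x : R) : is_CLim RtoC x (RtoC x).
Proof. split; simpl; [apply is_lim_id|apply is_lim_const]. Qed.

Lemma is_CLim_affine (F : R -> C) (a b x : R) (l : C) : a <> 0 ->
  is_CLim F (a * x + b) l -> is_CLim (fun t => F (a * t + b)) x l.
Proof.
intros Ha [Hr Hi].
split; [apply (is_lim_comp_lin (fun t => Re (F t)) a b x)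
  |apply (is_lim_comp_lin (fun t => Im (F t)) a b x)]; assumption.
Qed.

Lemma is_lim_slope (f : R -> R) (x l : R) : is_derive f x l -> f x = 0 ->
  is_lim (fun t => f t / (t - x)) x l.
Proof.
intros Hf H0. apply is_derive_Reals in Hf. apply is_lim_spec.
intros eps. destruct (Hf eps (cond_pos eps)) as [d Hd].
exists d. intros y Hy Hn. change R in y.
specialize (Hd (y - x) ltac:(lra) Hy). replace (x + (y - x)) with y in Hd by ring.
rewrite H0, Rminus_0_r in Hd. exact Hd.
Qed.

Lemma is_lim_hospital (f g : R -> R) (x l m : R) :
  is_derive f x l -> is_derive g x m -> f x = 0 -> g x = 0 -> m <> 0 ->
  is_lim (fun t => f t / g t) x (l / m).
Proof.
intros Hf Hg F0 G0 Hm.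
apply is_lim_ext_loc with (fun t => (f t / (t - x)) / (g t / (t - x))).
- exists (mkposreal 1 Rlt_0_1). intros y _ Hn. change R in y. unfold Rdiv.
  rewrite Rinv_mult, Rinv_inv.
  transitivity (f y * / g y * ((y - x) * / (y - x))); [ring|].
  rewrite Rinv_r by lra. ring.
- apply (is_lim_div (fun t => f t / (t - x)) (fun t => g t / (t - x)) x l m).
  + apply is_lim_slope; assumption.
  + apply is_lim_slope; assumption.
  + intros E. apply Hm. injection E; auto.
  + exact I.
Qed.

Lemma sin_int_PI (p : Z) : sin (IZR p * PI) = 0.
Proof. apply sin_eq_0_1. exists p. reflexivity. Qed.

(** At an integer order the numerator and [sin (mu PI)] both vanish, the numerator
    is differentiable in the order, and the sine has a simple zero. The limit in the
    definition of [besselK] is therefore a genuine one, and identities between the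
    quotients pass to it. *)
Lemma is_CLim_besselK (p : Z) (z : C) : z <> RtoC 0 ->
  is_CLim (fun mu => macdonald_quotient mu z) (IZR p) (besselK (IZR p) z).
Proof.
intros Hz.
assert (Hder : ex_Cderive (fun mu => besselI (- mu) z - besselI mu z)%C (IZR p)).
{ apply ex_Cderive_ext with (fun mu => besselI (- mu) z + RtoC (- (1)) * besselI mu z)%C.
  - intros t. rewrite RtoC_opp. ring.
  - apply ex_Cderive_plus.
    + apply (ex_Cderive_comp (fun t => besselI t z) Ropp);
        [apply ex_Cderive_besselI, Hz|auto_derive; exact I].
    + apply ex_Cderive_mult; [apply ex_Cderive_const|apply ex_Cderive_besselI, Hz]. }
assert (Hsin : is_derive (fun mu => sin (mu * PI)) (IZR p) (cos (IZR p * PI) * PI))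
  by (auto_derive; [exact I|ring]).
assert (Hcos : cos (IZR p * PI) * PI <> 0).
{ apply Rmult_integral_contrapositive_currified; [|apply PI_neq0].
  intros E. pose proof (sin2_cos2 (IZR p * PI)) as S. rewrite E, sin_int_PI in S.
  unfold Rsqr in S. lra. }
assert (H0 : (besselI (- IZR p) z - besselI (IZR p) z)%C = RtoC 0)
  by (rewrite besselI_opp_int by exact Hz; ring).
destruct Hder as [[lr Hr] [li Hi]]. change R in lr. change R in li.
assert (Hlim : is_CLim (fun mu => macdonald_quotient mu z) (IZR p)
  (RtoC (PI / 2) * ((lr / (cos (IZR p * PI) * PI))%R, (li / (cos (IZR p * PI) * PI))%R))%C).
{ apply is_CLim_ext with (fun mu => RtoC (PI / 2) *
    ((Re (besselI (- mu) z - besselI mu z)%C / sin (mu * PI))%R,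
     (Im (besselI (- mu) z - besselI mu z)%C / sin (mu * PI))%R))%C.
  - intros t. unfold macdonald_quotient, RtoC, Cmult, Re, Im, Rdiv. simpl. f_equal; ring.
  - apply is_CLim_mult; [apply is_CLim_const|].
    split;
      [apply (is_lim_hospital (fun mu => Re (besselI (- mu) z - besselI mu z)%C) (fun mu => sin (mu * PI)))
      |apply (is_lim_hospital (fun mu => Im (besselI (- mu) z - besselI mu z)%C) (fun mu => sin (mu * PI)))].
    all: try assumption; try apply sin_int_PI; rewrite H0; reflexivity. }
unfold besselK. destruct (Req_EM_T (sin (IZR p * PI)) 0) as [_|N].
- rewrite (is_CLim_unique _ _ _ Hlim). exact Hlim.
- destruct (N (sin_int_PI p)).
Qed.

Lemma macdonald_quotient_opp (mu : R) (z : C) :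
  macdonald_quotient (- mu) z = macdonald_quotient mu z.
Proof.
unfold macdonald_quotient.
rewrite Ropp_involutive, Ropp_mult_distr_l_reverse, sin_neg.
unfold Rdiv. rewrite Rinv_opp, Ropp_mult_distr_r_reverse, RtoC_opp. ring.
Qed.

(** Shifting [mu] by 1 negates [sin (mu PI)], hence also its inverse, even where the
    sine vanishes; so integer [mu] need no separate treatment. The sign turns the
    recurrences of [besselI] at [mu] and [- mu] into one with the opposite sign. *)
Lemma macdonald_quotient_recurrence (mu : R) (z : C) : z <> RtoC 0 ->
  (z / 2 * (macdonald_quotient (mu + 1) z - macdonald_quotient (mu - 1) z) =
   RtoC mu * macdonald_quotient mu z)%C.
Proof.
intros Hz. unfold macdonald_quotient.
replace ((mu + 1) * PI) with (mu * PI + PI) by ring.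
replace ((mu - 1) * PI) with (mu * PI - PI) by ring.
rewrite neg_sin, sin_minus, cos_PI, sin_PI.
replace (sin (mu * PI) * -1 - cos (mu * PI) * 0) with (- sin (mu * PI)) by ring.
unfold Rdiv. rewrite Rinv_opp, Ropp_mult_distr_r_reverse, RtoC_opp.
set (c := RtoC (PI * / 2 * / sin (mu * PI))).
replace (- (mu + 1)) with (- mu - 1) by ring.
replace (- (mu - 1)) with (- mu + 1) by ring.
pose proof (besselI_recurrence mu z Hz) as E1.
pose proof (besselI_recurrence (- mu) z Hz) as E2.
rewrite RtoC_opp in E2.
transitivity (c * (z / 2 * (besselI (mu + 1) z - besselI (mu - 1) z)
   + - (z / 2 * (besselI (- mu - 1) z - besselI (- mu + 1) z))))%C; [ring|].
rewrite E2.
transitivity (c * (- (z / 2 * (besselI (mu - 1) z - besselI (mu + 1) z))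
   + RtoC mu * besselI (- mu) z))%C; [ring|].
rewrite E1. ring.
Qed.

Lemma besselK_opp (p : Z) (z : C) : z <> RtoC 0 ->
  besselK (IZR (- p)) z = besselK (IZR p) z.
Proof.
intros Hz.
rewrite <- (is_CLim_unique _ _ _ (is_CLim_besselK p z Hz)). symmetry.
apply is_CLim_unique.
apply is_CLim_ext with (fun t => macdonald_quotient (-1 * t + 0) z).
- intros t. replace (-1 * t + 0) with (- t) by ring. apply macdonald_quotient_opp.
- apply (is_CLim_affine (fun t => macdonald_quotient t z)); [lra|].
  replace (-1 * IZR p + 0) with (IZR (- p)) by (rewrite opp_IZR; ring).
  apply is_CLim_besselK, Hz.
Qed.

Lemma besselK_recurrence (p : Z) (z : C) : z <> RtoC 0 ->
  (z / 2 * (besselK (IZR p + 1) z - besselK (IZR p - 1) z) = RtoC (IZR p) * besselK (IZR p) z)%C.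
Proof.
intros Hz.
assert (Hshift : forall s : Z, is_CLim (fun t => macdonald_quotient (t + IZR s) z) (IZR p)
   (besselK (IZR p + IZR s) z)).
{ intros s. apply is_CLim_ext with (fun t => macdonald_quotient (1 * t + IZR s) z).
  - intros t. rewrite Rmult_1_l. reflexivity.
  - apply (is_CLim_affine (fun t => macdonald_quotient t z)); [lra|].
    rewrite Rmult_1_l, <- plus_IZR. apply is_CLim_besselK, Hz. }
transitivity (CLim (fun t => RtoC t * macdonald_quotient t z)%C (IZR p)).
- symmetry. apply is_CLim_unique.
  apply is_CLim_ext with
    (fun t => z / 2 * (macdonald_quotient (t + 1) z - macdonald_quotient (t - 1) z))%C.
  + intros t. apply macdonald_quotient_recurrence, Hz.
  + apply is_CLim_mult; [apply is_CLim_const|].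
    apply is_CLim_minus; [apply (Hshift 1%Z)|apply (Hshift (-1)%Z)].
- apply is_CLim_unique, is_CLim_mult; [apply is_CLim_RtoC|apply is_CLim_besselK, Hz].
Qed.

(** * The symmetric sums *)

(** The pair of properties of [p |-> K_p (2 w)] that the symmetry rests on. *)
Definition even_bessel_sequence (w : C) (kappa : Z -> C) : Prop :=
  (forall p, kappa (- p)%Z = kappa p) /\
  (forall p, w * (kappa (p + 1)%Z - kappa (p - 1)%Z) = RtoC (IZR p) * kappa p)%C.

Definition symmetric_coef (m k : nat) : R :=
  INR (fact (m + k + 1)) /
    (INR (fact m) * INR (fact (m + 1)) * INR (fact k) * INR (fact (k + 1))).

Definition symmetric_term (kappa : Z -> C) (w : C) (m k : nat) : C :=
  (RtoC (symmetric_coef m k) * kappa (Z.of_nat m + 1 - Z.of_nat k)%Z * w ^ (m + k))%C.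

Lemma symmetric_coef_comm (m k : nat) : symmetric_coef m k = symmetric_coef k m.
Proof. unfold symmetric_coef. rewrite (Nat.add_comm k m). f_equal. ring. Qed.

Lemma INR_fact_add_1 (a : nat) : INR (fact (a + 1)) = (INR a + 1) * INR (fact a).
Proof. rewrite Nat.add_1_r, fact_simpl, mult_INR, S_INR; reflexivity. Qed.

Lemma symmetric_coef_succ_r (m k : nat) :
  symmetric_coef m (S k) * ((INR k + 1) * (INR k + 2)) =
  symmetric_coef m k * (INR m + INR k + 2).
Proof.
unfold symmetric_coef.
rewrite (Nat.add_succ_r m k), !INR_fact_add_1, (fact_simpl k), (fact_simpl (m + k)).
rewrite !mult_INR, !S_INR, plus_INR.
pose proof (pos_INR m). pose proof (pos_INR k).
field. repeat split; try apply INR_fact_neq_0; lra.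
Qed.

(** With [p = n + 1 - m], the orders on the left are [p + 1] and, by parity,
    [p - 1], carrying the same coefficient; the recurrence turns the difference into
    a multiple of [kappa p]. *)
Lemma symmetric_term_difference (kappa : Z -> C) (w : C) (n m : nat) :
  even_bessel_sequence w kappa ->
  (symmetric_term kappa w (S n) m - symmetric_term kappa w m (S n) =
   RtoC (symmetric_coef m (S n) * (INR n + 1 - INR m))
     * kappa (Z.of_nat n + 1 - Z.of_nat m)%Z * w ^ (n + m))%C.
Proof.
intros [Heven Hrec]. unfold symmetric_term.
rewrite (symmetric_coef_comm (S n) m).
assert (K := Hrec (Z.of_nat n + 1 - Z.of_nat m)%Z).
rewrite minus_IZR, plus_IZR, <- !INR_IZR_INZ in K.
replace (Z.of_nat (S n) + 1 - Z.of_nat m)%Z with (Z.of_nat n + 1 - Z.of_nat m + 1)%Z by lia.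
rewrite <- (Heven (Z.of_nat m + 1 - Z.of_nat (S n))%Z).
replace (- (Z.of_nat m + 1 - Z.of_nat (S n)))%Z
  with (Z.of_nat n + 1 - Z.of_nat m - 1)%Z by lia.
replace (m + S n)%nat with (S (n + m)) by lia.
change (S n + m)%nat with (S (n + m)). simpl Cpow.
rewrite RtoC_mult.
match goal with |- _ = (RtoC ?c * ?d * ?k * ?x)%C =>
  transitivity (RtoC c * (d * k) * x)%C; [rewrite <- K; ring|ring] end.
Qed.

(** Both sides are multiples of [w ^ (n + m + 1) * kappa (n - m)], the left one by
    [symmetric_term_difference]. Their coefficients agree because
    [(n + 1) (n + 2) - (m + 1) (m + 2) = (n - m) (n + m + 3)]. *)
Lemma symmetric_term_exchange (kappa : Z -> C) (w : C) (n m : nat) :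
  even_bessel_sequence w kappa ->
  (symmetric_term kappa w (S n) (S m) - symmetric_term kappa w (S m) (S n) =
   symmetric_term kappa w n (S m) - symmetric_term kappa w m (S n))%C.
Proof.
intros H. rewrite (symmetric_term_difference kappa w n (S m) H).
unfold symmetric_term.
rewrite <- (proj1 H (Z.of_nat m + 1 - Z.of_nat (S n))%Z).
replace (- (Z.of_nat m + 1 - Z.of_nat (S n)))%Z
  with (Z.of_nat n + 1 - Z.of_nat (S m))%Z by lia.
replace (m + S n)%nat with (n + S m)%nat by lia.
rewrite <- !Cmult_assoc.
match goal with |- (RtoC ?c * ?x = RtoC ?a * ?x - RtoC ?b * ?x)%C =>
  replace (RtoC c) with (RtoC a - RtoC b)%C; [ring|] end.
rewrite <- RtoC_minus. f_equal.
assert (E1 := symmetric_coef_succ_r (S m) n).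
assert (E2 := symmetric_coef_succ_r (S n) m).
rewrite (symmetric_coef_comm (S n)), (symmetric_coef_comm (S n)) in E2.
rewrite (symmetric_coef_comm n (S m)).
rewrite !S_INR in *.
pose proof (pos_INR n). pose proof (pos_INR m).
apply Rmult_eq_reg_r with (INR m + 1 + INR n + 2); [|lra].
rewrite Rmult_minus_distr_r, <- E1.
replace (symmetric_coef m (S n) * (INR m + 1 + INR n + 2)) with
  (symmetric_coef m (S n) * (INR n + 1 + INR m + 2)) by ring.
rewrite <- E2. ring.
Qed.

Lemma symmetric_sum_succ (kappa : Z -> C) (w : C) (n m : nat) :
  even_bessel_sequence w kappa ->
  (sum_n (symmetric_term kappa w (S n)) m - sum_n (symmetric_term kappa w n) m =
   symmetric_term kappa w m (S n))%C.
Proof.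
intros H. induction m as [|m IH].
- rewrite !sum_O.
  assert (E := symmetric_term_difference kappa w n 0 H).
  replace (symmetric_term kappa w n 0) with
    (symmetric_term kappa w (S n) 0 - symmetric_term kappa w 0 (S n))%C; [ring|].
  rewrite E. unfold symmetric_term. do 3 f_equal.
  assert (S1 := symmetric_coef_succ_r 0 n). rewrite (symmetric_coef_comm n 0).
  pose proof (pos_INR n). simpl (INR 0) in *.
  apply Rmult_eq_reg_r with (INR n + 2); [|lra].
  replace (symmetric_coef 0 n * (INR n + 2)) with
    (symmetric_coef 0 n * (0 + INR n + 2)) by ring.
  rewrite <- S1. ring.
- rewrite !sum_Sn. change (@plus C_AbelianMonoid) with Cplus.
  assert (E := symmetric_term_exchange kappa w n m H).
  match goal with |- (?a + ?b - (?c + ?d) = ?e)%C =>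
    transitivity ((a - c) + (b - e) - d + e)%C; [ring|] end.
  rewrite IH, E. ring.
Qed.

Lemma symmetric_sum_symm (kappa : Z -> C) (w : C) (m n : nat) :
  even_bessel_sequence w kappa ->
  sum_n (symmetric_term kappa w m) n = sum_n (symmetric_term kappa w n) m.
Proof.
intros Hk.
assert (H : forall m d, sum_n (symmetric_term kappa w m) (m + d) =
                        sum_n (symmetric_term kappa w (m + d)) m).
{ clear m n. intros m d; induction d as [|d IH]; [rewrite Nat.add_0_r; reflexivity|].
  rewrite Nat.add_succ_r, sum_Sn, IH. unfold plus; simpl.
  rewrite <- (symmetric_sum_succ kappa w (m + d) m Hk). ring. }
destruct (Nat.le_ge_cases m n) as [L|L].
- replace n with (m + (n - m))%nat by lia. apply H.
- replace m with (n + (m - n))%nat by lia. symmetry; apply H.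
Qed.

(* Binomial.C is the (real-valued) binomial coefficient; unqualified C is the
   type of complex numbers. *)
Theorem theorem1 (m n : nat) (z : C)
  (hm : (0 < m)%nat) (hn : (0 < n)%nat) (hz : slit_plane z) :
  (RtoC (INR (fact (n + 1))) *
   sum_n (fun k : nat =>
     RtoC (/ INR (fact k) * Binomial.C (m + k + 1) m)
     * besselK (INR k - INR m - 1) z * (z / 2) ^ (k + m)) n
   =
   RtoC (INR (fact (m + 1))) *
   sum_n (fun k : nat =>
     RtoC (/ INR (fact k) * Binomial.C (n + k + 1) n)
     * besselK (INR k - INR n - 1) z * (z / 2) ^ (k + n)) m)%C.
Proof.
assert (Hz : z <> RtoC 0) by (intros ->; apply hz; simpl; lra).
set (kappa := fun p : Z => besselK (IZR p) z).
assert (Hkappa : even_bessel_sequence (z / 2)%C kappa).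
{ split; intros p; unfold kappa; [apply besselK_opp, Hz|].
  rewrite plus_IZR, minus_IZR. apply besselK_recurrence, Hz. }
assert (Hsum : forall a b : nat,
  (RtoC (INR (fact (b + 1))) *
   sum_n (fun k : nat =>
     RtoC (/ INR (fact k) * Binomial.C (a + k + 1) a)
     * besselK (INR k - INR a - 1) z * (z / 2) ^ (k + a)) b)%C =
  (RtoC (INR (fact (a + 1)) * INR (fact (b + 1))) *
   sum_n (symmetric_term kappa (z / 2)%C a) b)%C).
{ intros a b. rewrite RtoC_mult.
  rewrite (Cmult_comm (RtoC (INR (fact (a + 1))))), <- Cmult_assoc. f_equal.
  rewrite <- (sum_n_mult_l (K := C_Ring) (RtoC (INR (fact (a + 1))))
                (symmetric_term kappa (z / 2)%C a)).
  apply sum_n_ext. intros k. unfold symmetric_term.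
  change (@mult C_Ring) with Cmult.
  rewrite <- (proj1 Hkappa). unfold kappa at 1.
  replace (IZR (- (Z.of_nat a + 1 - Z.of_nat k))) with (INR k - INR a - 1)
    by (rewrite opp_IZR, minus_IZR, plus_IZR, <- !INR_IZR_INZ; ring).
  rewrite (Nat.add_comm k a), !Cmult_assoc, <- RtoC_mult. do 3 f_equal.
  unfold Binomial.C, symmetric_coef. replace (a + k + 1 - a)%nat with (k + 1)%nat by lia.
  field. repeat split; apply INR_fact_neq_0. }
rewrite !Hsum, (Rmult_comm (INR (fact (m + 1)))). f_equal.
apply symmetric_sum_symm, Hkappa.
Qed.
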